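(* Let $m,n\in\mathbb{N}$, let $\mathcal{L}:\mathbb{R}^{|A_{m,n}|}\to\mathbb{R}^{+}$ be a truncated loss that is differentiable and $\lambda$-convex (for some $\lambda>0$), and assume that the minimiser $C_\infty:=\mathrm{argmin}_{C\in\mathbb{R}^{|A_{m,n}|}}\mathcal{L}[C]$ exists and is unique. Let $C_0\in\mathbb{R}^{|A_{m,n}|}$ and let $C(t)$, $t\ge 0$, be a solution of the gradient flow $$\partial_t C(t)=-\nabla\mathcal{L}[C(t)],\qquad C(0)=C_0 .$$ Then both the loss $\mathcal{L}[C(t)]$ and the gradient descent $C(t)$ converge exponentially fast (to $\mathcal{L}[C_\infty]$ and $C_\infty$, respectively) as $t\to\infty$: for all $t\geq 0$, $$\frac{\lambda}{2}\,\|C(t)-C_\infty\|^2\;\le\;\mathcal{L}[C(t)]-\mathcal{L}[C_\infty]\;\le\; e^{-2\lambda t}\,\big(\mathcal{L}[C_0]-\mathcal{L}[C_\infty]\big).$$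
   Context: $A_{m,n}=\{\alpha\in\mathbb{N}^m:\max_i\alpha_i\le n\}$, so $|A_{m,n}|=(n+1)^m$; $\|\cdot\|$ is the Euclidean norm; $\mathbb{R}^+$ denotes the non-negative reals. $\Pi_{m,n}$ is the space of real polynomials in $m$ variables spanned by the monomials $x^\alpha$, $\alpha\in A_{m,n}$. Fixing a basis $(L_\alpha)_{\alpha\in A_{m,n}}$ of $\Pi_{m,n}$ (the Lagrange basis on the tensor Legendre grid), a coefficient vector $C=(c_\alpha)_{\alpha\in A_{m,n}}$ is identified with the polynomial $Q_C=\sum_{\alpha}c_\alpha L_\alpha$. A truncated loss is a non-negative function $\mathcal{L}[C]=\mathcal{L}(Q_C)$ of the coefficients obtained from a (PDE) loss functional on $\Pi_{m,n}$; $\nabla$ is the gradient with respect to $C$. A differentiable function $\mathcal{F}:\mathbb{R}^{N}\to\mathbb{R}$ is called $\lambda$-convex, $\lambda>0$, if for all $x,y\in\mathbb{R}^{N}$ $$\mathcal{F}[x]\ge\mathcal{F}[y]+\nabla\mathcal{F}[y]^{T}(x-y)+\frac{\lambda}{2}\|x-y\|^2 .$$ *)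

(* Defs.v *)
From HB Require Import structures.
From mathcomp Require Import all_boot all_order all_algebra.
From mathcomp Require polyrcf.
(* The notations of mpoly clash with those of MathComp-Analysis. *)
From mathcomp Require Import -(notations) mpoly.
From mathcomp Require Import all_classical all_reals all_analysis.

Set Implicit Arguments.
Unset Strict Implicit.
Unset Printing Implicit Defensive.

Import Order.TTheory GRing.Theory Num.Theory.
Import numFieldNormedType.Exports.

Local Open Scope classical_set_scope.
Local Open Scope ring_scope.

(* A_{m,n}: the value at i is the exponent of the i-th variable. *)
Definition multi_index (m n : nat) : finType := {ffun 'I_m -> 'I_n.+1}.

Lemma card_multi_index (m n : nat) : #|multi_index m n| = (n.+1 ^ m)%N.
Proof. by rewrite card_ffun !card_ord. Qed.

(* R^{|A_{m,n}|}; the coordinate of alpha sits in column enum_rank alpha. *)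
Notation coeffs R m n := ('rV[R]_#|multi_index m n|).

(* Rodrigues' formula. *)
Definition legendre (R : realType) (n : nat) : {poly R} :=
  (2 ^+ n * n`!%:R)^-1 *: (('X^2 - 1) ^+ n)^`(n).

(* The n + 1 Gauss-Legendre nodes in increasing order. *)
Definition legendre_node (R : realType) (n : nat) (k : 'I_n.+1) : R :=
  (polyrcf.rootsR (legendre R n.+1))`_k.

Section Lagrange.
Variables (R : realType) (m n : nat).

Definition in_Pi : pred (mpoly m R) := fun Q =>
  all (fun mu : multinom m => [forall i, mu i <= n]%N) (msupp Q).

(* The span of the monomials x^mu with all exponents at most n. *)
Definition Pi := {Q : mpoly m R | in_Pi Q}.

Definition lagrange1 (i : 'I_m) (j : 'I_n.+1) : mpoly m R :=
  \prod_(k < n.+1 | k != j)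
    ((legendre_node R j - legendre_node R k)^-1 *:
       (mpolyX R (mnm1 i) - mpolyC m (legendre_node R k))).

(* With x_beta the grid point of coordinates legendre_node R (beta i), this is
   the element of Pi_{m,n} equal to 1 at x_alpha and to 0 at the other x_beta. *)
Definition lagrange (alpha : multi_index m n) : mpoly m R :=
  \prod_(i < m) lagrange1 i (alpha i).

Definition lagrange_comb (C : coeffs R m n) : mpoly m R :=
  \sum_(alpha : multi_index m n) C 0 (enum_rank alpha) *: lagrange alpha.

Let deg_le (i : 'I_m) (d : nat) (Q : mpoly m R) : Prop :=
  forall mu, mu \in msupp Q -> (mu i <= d)%N.

Let deg_leW i d d' Q : (d <= d')%N -> deg_le i d Q -> deg_le i d' Q.
Proof. by move=> dd' h mu /h /leq_trans; apply. Qed.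

Let deg_leD i d P Q : deg_le i d P -> deg_le i d Q -> deg_le i d (P + Q).
Proof.
move=> hP hQ mu /msuppD_le; rewrite mem_cat.
by case/orP => [/hP|/hQ].
Qed.

Let deg_leZ i d c Q : deg_le i d Q -> deg_le i d (c *: Q).
Proof. by move=> hQ mu /msuppZ_le /hQ. Qed.

Let deg_leC i c : deg_le i 0 (mpolyC m c).
Proof.
move=> mu; rewrite msuppC; case: eqP => // _.
by rewrite inE => /eqP ->; rewrite mnm0E.
Qed.

Let deg_leX i l : deg_le i (l == i) (mpolyX R (mnm1 l)).
Proof.
by move=> mu; rewrite msuppX inE => /eqP ->; rewrite mnm1E.
Qed.

Let deg_leM i d e P Q :
  deg_le i d P -> deg_le i e Q -> deg_le i (d + e) (P * Q).
Proof.
move=> hP hQ mu /msuppM_le /allpairsP [[a b] /= [/hP ha /hQ hb ->]].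
by rewrite mnmDE leq_add.
Qed.

Let deg_le_prod (I : Type) (r : seq I) (p : pred I) i (d : I -> nat) F :
  (forall j, p j -> deg_le i (d j) (F j)) ->
  deg_le i (\sum_(j <- r | p j) d j)%N (\prod_(j <- r | p j) F j).
Proof.
move=> h; apply: (big_rec2 (fun e Q => deg_le i e Q)); first exact: deg_leC.
by move=> j e Q pj hQ; apply: deg_leM => //; apply: h.
Qed.

Let deg_le_lagrange1 i l j : deg_le i ((l == i) * n) (lagrange1 l j).
Proof.
have : deg_le i (\sum_(k < n.+1 | k != j) (l == i))%N (lagrange1 l j).
  apply: deg_le_prod => k _; apply: deg_leZ; apply: deg_leD; first exact: deg_leX.
  by rewrite -mpolyCN; apply: deg_leW (leq0n _) _; exact: deg_leC.
by rewrite sum_nat_const cardC1 card_ord mulnC.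
Qed.

Lemma lagrange_comb_in_Pi (C : coeffs R m n) : in_Pi (lagrange_comb C).
Proof.
suff h i : deg_le i n (lagrange_comb C).
  by apply/allP => mu hmu; apply/forallP => i; apply: h.
rewrite /lagrange_comb; apply: (big_ind (fun Q => deg_le i n Q)).
- by apply: deg_leW (leq0n n) _; rewrite -(mpolyC0 m R); exact: deg_leC.
- by move=> P Q; exact: deg_leD.
move=> alpha _; apply: deg_leZ.
have := @deg_le_prod _ (index_enum 'I_m) xpredT i _ _
  (fun l _ => @deg_le_lagrange1 i l (alpha l)).
apply: deg_leW; rewrite (bigD1 i) //= eqxx mul1n big1 ?addn0 // => l /negPf ->.
by rewrite mul0n.
Qed.

(* The polynomial Q_C with coefficient vector C. *)
Definition poly_of_coeffs (C : coeffs R m n) : Pi :=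
  exist _ (lagrange_comb C) (lagrange_comb_in_Pi C).

Definition truncated_loss (L : coeffs R m n -> R) : Prop :=
  (forall C, 0 <= L C) /\
  exists ell : Pi -> R, forall C, L C = ell (poly_of_coeffs C).

End Lagrange.

Section Euclidean.
Variables (R : realType) (N : nat).
Implicit Types (F : 'rV[R]_N -> R) (x y : 'rV[R]_N).

Definition dot x y : R := \sum_(i < N) x 0 i * y 0 i.

(* The library norm `|x| on 'rV[R]_N is the sup norm. *)
Definition enorm x : R := Num.sqrt (dot x x).

Definition gradient F x : 'rV[R]_N := \row_(i < N) 'D_(delta_mx 0 i) F x.

Definition lambda_convex (lambda : R) F : Prop :=
  forall x y,
    F x >= F y + dot (gradient F y) (x - y) + lambda / 2 * enorm (x - y) ^+ 2.

Definition argmin F : set 'rV[R]_N := [set x | forall y, F x <= F y].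

(* At t = 0 the derivative is one-sided; values C t for t < 0 are irrelevant. *)
Definition gradient_flow F (C0 : 'rV[R]_N) (C : R -> 'rV[R]_N) : Prop :=
  [/\ C 0 = C0,
      h^-1 *: (C h - C 0) @[h --> 0^'+] --> - gradient F (C 0)
    & forall t : R, 0 < t -> is_derive t 1 C (- gradient F (C t))].

End Euclidean.

(* Main.v *)
Require Import Defs.
From HB Require Import structures.
From mathcomp Require Import all_boot all_order all_algebra.
From mathcomp Require Import all_classical all_reals all_analysis.
From mathcomp Require Import ring lra.

Import Order.TTheory GRing.Theory Num.Theory.
Import numFieldNormedType.Exports.

Local Open Scope classical_set_scope.
Local Open Scope ring_scope.

(* With g := L(C) - L(Cinf), convexity at C(t) gives the Polyak-Lojasiewicz
   inequality 2 lambda g <= |grad L|^2, and g' = - |grad L|^2 along the flow, so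
   that e^(2 lambda t) g(t) is nonincreasing. Convexity at Cinf, where the
   gradient vanishes, bounds the squared distance by g. *)

Section GradientFlow.
Set Implicit Arguments.
Unset Strict Implicit.

Lemma enorm_sq (R : realType) (N : nat) (x : 'rV[R]_N) :
  enorm x ^+ 2 = dot x x.
Proof. by rewrite sqr_sqrtr // sumr_ge0 // => i _; rewrite -expr2 sqr_ge0. Qed.

(** Transfers Euclidean bounds to the sup norm, in which limits are taken: the square of each
    coordinate is one term of the sum of squares. *)
Lemma norm_le_enorm (R : realType) (N : nat) (x : 'rV[R]_N) : `|x| <= enorm x.
Proof.
rewrite [`|x|]mx_normrE; apply: bigmax_le => [|[i j] _ /=]; first exact: sqrtr_ge0.
rewrite (ord1 i) -sqrtr_sqr ler_sqrt; last first.
  by rewrite sumr_ge0 // => k _; rewrite -expr2 sqr_ge0.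
rewrite /dot (bigD1 j) //= expr2 lerDl sumr_ge0 // => k _.
by rewrite -expr2 sqr_ge0.
Qed.

Section LambdaConvex.
Variables (R : realType) (N : nat) (F : 'rV[R]_N -> R).
Hypothesis dF : forall x, differentiable F x.

(** The differential is linear, so its value at [v] is fixed by its values on the canonical basis,
    which are the partial derivatives. *)
Lemma dot_gradient x v : dot (gradient F x) v = 'd F x v.
Proof.
rewrite {2}(row_sum_delta v) linear_sum; apply: eq_bigr => i _.
by rewrite linearZ mxE deriveE //= mulrC.
Qed.

(** The difference quotients of [F] at a minimiser are nonnegative for positive steps, hence so is
    their limit from the right. *)
Lemma dot_gradient_argmin_ge0 y v : argmin F y -> 0 <= dot (gradient F y) v.
Proof.
move=> ymin; rewrite dot_gradient -deriveE //.
have /cvg_dnbhs_at_right h : derivable F y v by exact: diff_derivable.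
apply: (cvgr_to_ge h); near=> t; apply: mulr_ge0; last first.
  by rewrite subr_ge0; exact: ymin.
by rewrite invr_ge0; near: t; exact: nbhs_right_ge.
Unshelve. all: by end_near. Qed.

Variable lambda : R.
Hypothesis lambda_gt0 : 0 < lambda.
Hypothesis cF : lambda_convex lambda F.

Lemma quadratic_growth x y : argmin F y ->
  lambda / 2 * enorm (x - y) ^+ 2 <= F x - F y.
Proof.
move=> /(dot_gradient_argmin_ge0 (x - y)) g0.
by have := cF x y; lra.
Qed.

Lemma polyak_lojasiewicz x y :
  2 * lambda * (F x - F y) <= dot (gradient F x) (gradient F x).
Proof.
(* This is the expanded square of the norm of [gradient F x + lambda *: (y - x)], which vanishes at
   the minimiser in [y] of the quadratic lower bound given by convexity at [x]. *)
have : 0 <= 2 * lambda * dot (gradient F x) (y - x)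
    + lambda ^+ 2 * dot (y - x) (y - x) + dot (gradient F x) (gradient F x).
  rewrite /dot !mulr_sumr -!big_split /=; apply: sumr_ge0 => i _.
  set g := gradient F x 0 i; set d := (y - x) 0 i.
  by rewrite (_ : _ + _ = (g + lambda * d) ^+ 2) ?sqr_ge0 //; ring.
have := cF y x; rewrite enorm_sq => /(ler_wpM2l (ltW lambda_gt0)).
nra.
Qed.

End LambdaConvex.

(** The increment [f h - f 0] is [h] times the difference quotient, so it tends to [0 *: l]. *)
Lemma right_derivative_cvg (R : realType) (V : normedModType R)
    (f : R -> V) (l : V) :
  h^-1 *: (f h - f 0) @[h --> 0^'+] --> l -> f h @[h --> 0^'+] --> f 0.
Proof.
move=> fl; apply/subr_cvg0.
have id0 : (h : R) @[h --> 0^'+] --> (0 : R).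
  exact: (@cvg_at_right_filter _ _ id).
have h0 : h *: (h^-1 *: (f h - f 0)) @[h --> 0^'+] --> (0 : V).
  by rewrite -(scale0r l); exact: cvgZ.
apply: cvg_trans h0; apply: near_eq_cvg.
near=> h; rewrite scalerA divff ?scale1r //.
Unshelve. all: by end_near. Qed.

Lemma gradient_flow_right_cvg (R : realType) (N : nat) (F : 'rV[R]_N -> R) C0 C :
  gradient_flow F C0 C -> C h @[h --> 0^'+] --> C 0.
Proof. by case=> _ C'0 _; exact: right_derivative_cvg C'0. Qed.

(** Chain rule: the differential of [F] at [C t] is applied to the velocity [- gradient F (C t)]. *)
Lemma gradient_flow_dissipation (R : realType) (N : nat) (F : 'rV[R]_N -> R) C0 C
    (t : R) :
  (forall x, differentiable F x) -> gradient_flow F C0 C -> 0 < t ->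
  is_derive t 1 (F \o C) (- dot (gradient F (C t)) (gradient F (C t))).
Proof.
move=> dF [_ _ dC] t0; have [Ct CtE] := dC t t0.
have dCt : differentiable C t by exact/derivable1_diffP.
have dFC : differentiable (F \o C) t by exact: differentiable_comp.
apply: DeriveDef; first exact: diff_derivable.
rewrite deriveE // diff_comp //=.
have -> : 'd C t 1 = - gradient F (C t) by rewrite -deriveE.
by rewrite linearN -dot_gradient.
Qed.

Lemma gradient_flow_decay (R : realType) (N : nat) (F : 'rV[R]_N -> R) C0 C
    (lambda : R) y (t : R) :
  (forall x, differentiable F x) -> 0 < lambda -> lambda_convex lambda F ->
  gradient_flow F C0 C -> 0 <= t ->
  F (C t) - F y <= expR (- 2 * lambda * t) * (F C0 - F y).
Proof.
move=> dF l0 cF flow t0; set k := 2 * lambda.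
have [C_0 _ _] := flow.
pose phi := fun s : R => expR (k * s) * (F (C s) - F y).
have dphi (s : R) : 0 < s -> is_derive s 1 phi
    (expR (k * s) * (k * (F (C s) - F y)
                     - dot (gradient F (C s)) (gradient F (C s)))).
  move=> s0; have dFC := gradient_flow_dissipation dF flow s0.
  pose e := fun s : R => expR (k * s).
  have de : is_derive s 1 e (expR (k * s) * k).
    apply: (@is_derive1_comp _ expR ( *%R k)).
    by apply: is_derive_eq; rewrite /GRing.scale /= mulr1.
  apply: (@is_derive_eq _ _ _ (e * ((F \o C) - cst (F y)))).
  rewrite /e /GRing.scale /=; rewrite !fctE; ring.
(* The flow is differentiable in the two-sided sense only for positive times; at 0 continuity from
   the right comes from the one-sided derivative. *)
have phi_cont : {within `[0, +oo[, continuous phi}.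
  apply/continuous_within_itvcyP; split.
    move=> s; rewrite in_itv /= andbT => /dphi [ds _].
    by apply: differentiable_continuous; exact/derivable1_diffP.
  apply: cvgM.
    apply: cvg_at_right_filter; apply: continuous_comp; last exact: continuous_expR.
    exact: mulrl_continuous.
  apply: cvgB; last exact: cvg_cst.
  have FC : {for C 0, continuous F} by exact: differentiable_continuous.
  exact: cvg_comp (gradient_flow_right_cvg flow) FC.
have : phi t <= phi 0.
  apply: (@ler0_derive1_nincry _ phi 0) => // s; rewrite in_itv /= andbT.
    by move=> /dphi [].
  (* The exponential factor is positive, so the sign of the derivative is that of the bracket, which
     the Polyak-Lojasiewicz inequality makes nonpositive. *)
  move=> /dphi ds; rewrite derive1E derive_val pmulr_rle0 ?expR_gt0 // subr_le0.
  exact: polyak_lojasiewicz.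
rewrite /phi mulr0 expR0 mul1r C_0 => /(ler_wpM2l (expR_ge0 (- 2 * lambda * t))).
rewrite mulrA -expRD (_ : _ + _ = 0) ?expR0 ?mul1r //.
by rewrite /k; ring.
Qed.

End GradientFlow.

Theorem theorem14 (R : realType) (m n : nat)
    (L : coeffs R m n -> R) (lambda : R)
    (Cinf C0 : coeffs R m n) (C : R -> coeffs R m n) :
  truncated_loss L ->
  (forall x, differentiable L x) ->
  0 < lambda ->
  lambda_convex lambda L ->
  argmin L = [set Cinf] ->
  gradient_flow L C0 C ->
  [/\ L (C t) @[t --> +oo] --> L Cinf,
      C t @[t --> +oo] --> Cinf
    & forall t : R, 0 <= t ->
        lambda / 2 * enorm (C t - Cinf) ^+ 2 <= L (C t) - L Cinf /\
        L (C t) - L Cinf <= expR (- 2 * lambda * t) * (L C0 - L Cinf)].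
Proof.
move=> _ dL l0 cL minL flow.
have minC : argmin L Cinf by rewrite minL.
have growth t := quadratic_growth dL cL (C t) minC.
have decay t := gradient_flow_decay (t := t) Cinf dL l0 cL flow.
(* The gap is squeezed between 0, by minimality of [Cinf], and the decaying exponential bound. *)
have LC : L (C t) - L Cinf @[t --> +oo] --> 0.
  have e0 : expR (- 2 * lambda * t) * (L C0 - L Cinf) @[t --> +oo] --> 0.
    rewrite -(mul0r (L C0 - L Cinf)); apply: cvgMr_tmp.
    under eq_cvg do rewrite !mulNr.
    apply: (cvg_comp ( *%R (2 * lambda)) (fun x => expR (- x)));
      last exact: cvgr_expR.
    by apply: gt0_cvgMry => //; rewrite mulr_gt0.
  apply: (squeeze_cvgr _ (cvg_cst 0) e0); near=> t.
  rewrite subr_ge0 minC /= decay //.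
split=> [||t t0]; first exact/subr_cvg0.
  apply/cvgrPdist_le => e e0.
  (* By quadratic growth, a gap of at most [lambda / 2 * e ^+ 2] forces the Euclidean distance to
     [Cinf] to be at most [e]. *)
  have le0 : 0 < lambda / 2 * e ^+ 2 by rewrite mulr_gt0 ?exprn_gt0 ?divr_gt0.
  near=> t.
  have small : L (C t) - L Cinf <= lambda / 2 * e ^+ 2.
    by near: t; exact: (cvgr_le _ LC).
  rewrite distrC (le_trans (norm_le_enorm _)) //.
  rewrite -ler_sqr ?nnegrE ?sqrtr_ge0 ?(ltW e0) //.
  rewrite -(@ler_pM2l _ (lambda / 2)) ?divr_gt0 //.
  exact: le_trans (growth t) small.
by split; [exact: growth | exact: decay].
Unshelve. all: by end_near. Qed.
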